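(* Let $R$ be a unique factorization domain and let $n$ be a positive integer. (a) Let $p_1,p_2,\ldots,p_n$ be nonzero elements of $R$. Suppose that for every $1\le i<j\le n$ the greatest common divisor of $p_i$ and $p_j$ can be represented as a linear combination of them, i.e. $\gcd(p_i,p_j)=u_{ij}p_i+u_{ji}p_j$ for some $u_{ij},u_{ji}\in R$. Then there exist elements $w_1,w_2,\ldots,w_n\in R$ such that $\gcd(p_1,p_2,\ldots,p_n)=w_1p_1+w_2p_2+\ldots+w_np_n$. (b) Let $I_1,I_2,\dots,I_n$ be principal ideals in $R$ such that $I_i+I_j$ is a principal ideal for every pair of indices $1\le i,j\le n$. Then $I_1+I_2+\dots+I_n$ is also a principal ideal.
   Context: Greatest common divisors in a unique factorization domain are defined up to multiplication by a unit; the hypothesis and the conclusion of (a) do not depend on the choice of representatives. *)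

(* Defs.v *)
From mathcomp Require Import all_boot all_algebra.
From mathcomp Require Import classical_sets.

Set Implicit Arguments.
Unset Strict Implicit.
Unset Printing Implicit Defensive.

Import GRing.Theory.
Local Open Scope classical_set_scope.
Local Open Scope ring_scope.

Section Factoriality.
Variable R : idomainType.

Definition divides (a b : R) : Prop := exists c, b = c * a.

Definition associated (a b : R) : Prop :=
  exists2 u : R, u \is a GRing.unit & b = u * a.

Definition irreducible (q : R) : Prop :=
  [/\ q != 0, q \isn't a GRing.unit &
      forall a b : R, q = a * b -> a \is a GRing.unit \/ b \is a GRing.unit].

(* The empty list is allowed, so that [1] has the empty factorization; other
   units and the nonunits are covered alike since the factorization is only
   asked up to association. *)
Definition has_factorizations : Prop :=
  forall x : R, x != 0 ->
    exists2 s : seq R, {in s, forall q, irreducible q} &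
                       associated (\prod_(q <- s) q) x.

Definition unique_factorizations : Prop :=
  forall s t : seq R,
    {in s, forall q, irreducible q} -> {in t, forall q, irreducible q} ->
    associated (\prod_(q <- s) q) (\prod_(q <- t) q) ->
    exists t' : seq R,
      [/\ perm_eq t t', size s = size t' &
          forall i, (i < size s)%N -> associated s`_i t'`_i].

Definition is_ufd : Prop := has_factorizations /\ unique_factorizations.

(* A greatest common divisor is only determined up to a unit, hence a relation
   rather than a function. *)
Definition is_gcd (s : seq R) (d : R) : Prop :=
  {in s, forall a, divides d a} /\
  forall c : R, {in s, forall a, divides c a} -> divides c d.

(* Ideals are Prop-valued sets: the ideals of [ring_quotient] are proper and
   carry a boolean membership test, which sums need not have. *)
Definition principal_ideal (I : set R) : Prop :=
  exists a : R, I = [set c * a | c in [set: R]].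

Definition ideal_add (I J : set R) : set R := [set x + y | x in I & y in J].

Definition ideal_sum (n : nat) (I : 'I_n -> set R) : set R :=
  [set \sum_i x i | x in [set x : 'I_n -> R | forall i, I i (x i)]].

End Factoriality.

(* Main.v *)
Require Import Defs.
From mathcomp Require Import all_boot all_algebra.
From mathcomp Require Import classical_sets.
From mathcomp Require Import ring.

(** Say that [a] and [b] have a Bezout gcd [d] when [d] divides both and is a
    linear combination of them, that is, [(a, b) = (d)].  Both parts of the
    theorem follow from one fact about a family whose members pairwise have
    Bezout gcds: some element of the ideal it generates divides all of it.  By
    induction on the size of the family, replacing two members [a], [b] by
    their Bezout gcd [d] changes neither the ideal nor the common divisors, so
    the only question is whether [d] still has a Bezout gcd with every other
    member [c]; this is [bezout_gcd_merge].

    If [c = 0] it is trivial. When [c != 0] and [gcd (d, c) = 1], it goes as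
    follows. Let [(a, c) = (g)] and [(b, c) = (h)]; then [u * (a / g) + v * (c
    / g) = 1] for some [u], [v]. Any two of [d], [g], [h] are coprime, because
    a common divisor of two of them divides [a], [b] and [c], hence [d] and
    [c]. As [d] and [g] divide [a], the product [d * g] divides [a], and
    likewise [g * h] divides [c]; hence [a / g] is a multiple of [d] and [c /
    g] one of [h], and [1] lies in [(d, h)], which is contained in [(a, b, c)
    = (d, c)].

    Unique factorization enters only through the existence of gcds, which
    reduces the lemma to the coprime case and gives Gauss's lemma, by which
    coprime divisors of an element have their product dividing it. In a unique
    factorization domain irreducible elements are prime, and a gcd of a
    product of primes with [b] is built by cancelling the primes one by one.
    *)

Set Implicit Arguments.
Unset Strict Implicit.
Unset Printing Implicit Defensive.

Import GRing.Theory.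
Local Open Scope classical_set_scope.
Local Open Scope ring_scope.

Section Divisibility.
Variable R : idomainType.
Implicit Types a b c d x y : R.

Lemma dividesxx a : divides a a.
Proof. by exists 1; rewrite mul1r. Qed.

Lemma divides0 a : divides a 0.
Proof. by exists 0; rewrite mul0r. Qed.

Lemma divides1 a : divides 1 a.
Proof. by exists a; rewrite mulr1. Qed.

Lemma divides_trans b a c : divides a b -> divides b c -> divides a c.
Proof. by move=> [x ->] [y ->]; exists (y * x); rewrite mulrA. Qed.

Lemma divides_mull a b c : divides a b -> divides a (c * b).
Proof. by move=> [x ->]; exists (c * x); rewrite mulrA. Qed.

Lemma divides_lin a b c x y :
  divides a b -> divides a c -> divides a (x * b + y * c).
Proof.
by move=> [b' ->] [c' ->]; exists (x * b' + y * c'); rewrite mulrDl !mulrA.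
Qed.

Lemma divides_mul2l c a b : divides a b -> divides (c * a) (c * b).
Proof. by move=> [x ->]; exists x; rewrite mulrCA. Qed.

Lemma divides_cancel c a b : c != 0 -> divides (c * a) (c * b) -> divides a b.
Proof.
move=> c0 [x e]; exists x; apply: (mulfI c0).
by rewrite e mulrCA.
Qed.

Lemma divides1_unit a : divides a 1 -> a \is a GRing.unit.
Proof. by move=> [x e]; apply/unitrPr; exists x; rewrite mulrC -e. Qed.

Lemma associated_divides a b : associated a b -> divides a b.
Proof. by move=> [u _ ->]; exists u. Qed.

Lemma associated_divides_sym a b : associated a b -> divides b a.
Proof. by move=> [u uU ->]; exists u^-1; rewrite mulKr. Qed.

Lemma divides_prod_mem x (s : seq R) : x \in s -> divides x (\prod_(y <- s) y).
Proof.
move=> xs; rewrite (big_rem x) //= mulrC.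
by exists (\prod_(y <- rem x s) y).
Qed.

Lemma is_gcd2P a b d :
  is_gcd [:: a; b] d <->
  [/\ divides d a, divides d b &
      forall c, divides c a -> divides c b -> divides c d].
Proof.
split=> [[dvd grt]|[da db grt]].
  split; [by apply: dvd; rewrite !inE eqxx | |].
    by apply: dvd; rewrite !inE eqxx orbT.
  by move=> c ca cb; apply: grt => x; rewrite !inE => /orP[]/eqP->.
split=> [x|c cs]; first by rewrite !inE => /orP[]/eqP->.
by apply: grt; apply: cs; rewrite !inE eqxx ?orbT.
Qed.

End Divisibility.

(** * Greatest common divisors in a unique factorization domain *)

Section Ufd.
Variable R : idomainType.
Implicit Types a b c d q x y : R.

Definition prime_elt q : Prop :=
  q != 0 /\ forall a b, divides q (a * b) -> divides q a \/ divides q b.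

(** If [q * z = a * b], then [q] appears, up to a unit, in any factorization of
    [a * b], in particular in the one obtained by juxtaposing a factorization
    of [a] and one of [b]. *)
Lemma ufd_irreducible_prime q : is_ufd R -> irreducible q -> prime_elt q.
Proof.
move=> [hasf uniqf] qirr; split=> [|a b [z zq]]; first by case: qirr.
have [->|a0] := eqVneq a 0; first by left; apply: divides0.
have [->|b0] := eqVneq b 0; first by right; apply: divides0.
have z0 : z != 0.
  by apply: contra_neq (mulf_neq0 a0 b0) => z0; rewrite zq z0 mul0r.
have [sa sa_irr [ua uaU ea]] := hasf a a0.
have [sb sb_irr [ub ubU eb]] := hasf b b0.
have [sz sz_irr [uz uzU ez]] := hasf z z0.
have [||| t' [pt _ assoc_t]] := uniqf (q :: sz) (sa ++ sb).
- by move=> x; rewrite inE => /orP[/eqP->|/sz_irr].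
- by move=> x; rewrite mem_cat => /orP[/sa_irr|/sb_irr].
- rewrite big_cons big_cat /=; exists (uz / (ua * ub)).
    by rewrite unitrM unitrV unitrM uzU uaU ubU.
  have uU : ua * ub \is a GRing.unit by rewrite unitrM uaU ubU.
  apply: (mulrI uU); rewrite !mulrA (mulrAC _ uz) mulrV // mul1r.
  have -> : uz * q * \prod_(j <- sz) j = z * q by rewrite ez; ring.
  by rewrite -zq ea eb; ring.
have q_t : divides q t'`_0 by apply: associated_divides; apply: (assoc_t 0%N).
have : t'`_0 \in sa ++ sb.
  rewrite (perm_mem pt) mem_nth //.
  (* If [t'] were empty then [q] would be associated to the default value 0. *)
  case: t' {pt} assoc_t q_t => [assoc_t _|//].
  have [u uU /= e0] := assoc_t 0%N isT.
  have [q0 _ _] := qirr.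
  by move/esym/eqP: e0; rewrite mulf_eq0 (negPf q0) orbF; case: eqP uU => // ->;
    rewrite unitr0.
rewrite mem_cat => /orP[] /divides_prod_mem t_s; [left; rewrite ea|right; rewrite eb];
  by apply: divides_mull; apply: divides_trans q_t t_s.
Qed.

Lemma prime_cancel_coprime q c x :
  prime_elt q -> ~ divides q c -> divides c (q * x) -> divides c x.
Proof.
move=> [q0 qP] nqc [k e].
have [|[k' ek]|//] := qP k c; first by rewrite -e mulrC; exists x.
by exists k'; apply: (mulfI q0); rewrite e ek; ring.
Qed.

(** A prime [q] dividing the first element either divides the second as well,
    and then it is a factor of the gcd, or it can be dropped. *)
Lemma gcd_prod_primes (s : seq R) b :
  {in s, forall q, prime_elt q} -> exists d, is_gcd [:: \prod_(q <- s) q; b] d.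
Proof.
elim: s b => [|q s IHs] b sP.
  exists 1; rewrite big_nil; apply/is_gcd2P.
  by split=> //; apply: divides1.
have qP : prime_elt q by apply: sP; rewrite mem_head.
have {}IHs b' : exists d, is_gcd [:: \prod_(x <- s) x; b'] d.
  by apply: IHs => x xs; apply: sP; rewrite inE xs orbT.
have q0 := qP.1.
rewrite big_cons; set P := \prod_(j <- s) j in IHs *.
have [[b' ->]|nqb] := boolp.EM (divides q b).
  have [d /is_gcd2P[dP db dgrt]] := IHs b'.
  exists (q * d); apply/is_gcd2P.
  rewrite (mulrC b'); split; [exact: divides_mul2l..|] => c cP cb.
  have [[c' ec]|nqc] := boolp.EM (divides q c).
    move: cP cb; rewrite ec (mulrC c') => cP cb.
    by apply: divides_mul2l; apply: dgrt; apply: divides_cancel q0 _.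
  by apply: divides_mull; apply: dgrt; apply: prime_cancel_coprime qP nqc _.
have [d /is_gcd2P[dP db dgrt]] := IHs b.
exists d; apply/is_gcd2P; split=> // [|c cP cb]; first exact: divides_mull.
apply: dgrt => //; apply: prime_cancel_coprime qP _ cP => qc.
by apply: nqb; apply: divides_trans qc cb.
Qed.

Lemma ufd_gcd a b : is_ufd R -> exists d, is_gcd [:: a; b] d.
Proof.
move=> ufdR; have [->|a0] := eqVneq a 0.
  exists b; apply/is_gcd2P.
  by split; [exact: divides0|exact: dividesxx|].
have [s s_irr assoc_s] := ufdR.1 a a0.
have [|d /is_gcd2P[ds db dgrt]] := @gcd_prod_primes s b.
  by move=> q /s_irr; apply: ufd_irreducible_prime.
exists d; apply/is_gcd2P; split=> // [|c ca cb].
  by apply: divides_trans ds _; apply: associated_divides.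
by apply: dgrt => //; apply: divides_trans ca _; apply: associated_divides_sym.
Qed.

End Ufd.

(** * Families whose members pairwise have Bezout gcds *)

Section BezoutGcd.
Variable R : idomainType.
Hypothesis gcdR : forall a b : R, exists d, is_gcd [:: a; b] d.
Implicit Types a b c d g h x y : R.

(** Gauss's lemma.  A gcd of [a * x] and [b * x] is [x * y] for some common
    divisor [y] of [a] and [b], that is, [x] up to a unit; and [a] divides
    it. *)
Lemma gauss_divides a b x :
  (forall y, divides y a -> divides y b -> y \is a GRing.unit) ->
  divides a (b * x) -> divides a x.
Proof.
move=> cop abx; have [->|x0] := eqVneq x 0; first exact: divides0.
have [e /is_gcd2P[ea eb egrt]] := gcdR (x * a) (x * b).
have [|| y ey] := egrt x.
- by exists a; rewrite mulrC.
- by exists b; rewrite mulrC.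
rewrite {}ey (mulrC y) in ea eb egrt.
have yU : y \is a GRing.unit.
  by apply: cop; [apply: divides_cancel x0 ea|apply: divides_cancel x0 eb].
have [|| k ek] := egrt a.
- exact/divides_mull/dividesxx.
- by rewrite mulrC.
by exists (y^-1 * k); rewrite -mulrA -ek (mulrC x) mulKr.
Qed.

Definition bezout_gcd a b d : Prop :=
  [/\ divides d a, divides d b & exists u v, d = u * a + v * b].

Lemma bezout_gcdC a b d : bezout_gcd a b d -> bezout_gcd b a d.
Proof. by move=> [da db [u [v e]]]; split=> //; exists v, u; rewrite addrC. Qed.

Lemma bezout_gcdxx a : bezout_gcd a a a.
Proof.
by split; [exact: dividesxx..|exists 1, 0]; rewrite mul1r mul0r addr0.
Qed.

Lemma bezout_gcdx0 a : bezout_gcd a 0 a.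
Proof.
split; [exact: dividesxx|exact: divides0|].
by exists 1, 0; rewrite mul1r mulr0 addr0.
Qed.

Lemma bezout_gcd_greatest a b d x :
  bezout_gcd a b d -> divides x a -> divides x b -> divides x d.
Proof. by move=> [_ _ [u [v ->]]]; apply: divides_lin. Qed.

(** The argument is the one given for [gcd (d, c) = 1], applied to [d], [g] and
    [h] divided by [t = gcd (d, c)]. *)
Lemma bezout_gcd_merge a b c d g h :
  bezout_gcd a b d -> bezout_gcd a c g -> bezout_gcd b c h ->
  exists t, bezout_gcd d c t.
Proof.
move=> abd acg bch.
have [->|c0] := eqVneq c 0; first by exists d; apply: bezout_gcdx0.
have [t /is_gcd2P[td tc tgrt]] := gcdR d c; exists t; split=> //.
have [da db _] := abd.
have [[a' ea] [c' ec] [u [v eg]]] := acg.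
have [[b' eb] hc [u' [v' eh]]] := bch.
have ta : divides t a := divides_trans td da.
have tb : divides t b := divides_trans td db.
have [g1 eg1] := bezout_gcd_greatest acg ta tc.
have [h1 eh1] := bezout_gcd_greatest bch tb tc.
have [d1 ed1] := td.
have g0 : g != 0 by apply: contra_neq c0 => g0; rewrite ec g0 mulr0.
have t0 : t != 0 by apply: contra_neq g0 => t0; rewrite eg1 t0 mulr0.
have copr y : divides (t * y) a -> divides (t * y) b -> divides (t * y) c ->
    y \is a GRing.unit.
  move=> ya yb yc; apply/divides1_unit/(divides_cancel t0); rewrite mulr1.
  by apply: tgrt yc; apply: bezout_gcd_greatest abd ya yb.
have lift y x x1 : x = x1 * t -> divides y x1 -> divides (t * y) x.
  by move=> ->; rewrite (mulrC x1); apply: divides_mul2l.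
have da' : divides d1 a'.
  apply: (@gauss_divides d1 g1) => [y yd yg|].
    have yd' := lift _ _ _ ed1 yd; have yg' := lift _ _ _ eg1 yg.
    apply: copr; [exact: divides_trans da|exact: divides_trans db|].
    by rewrite ec; apply: divides_mull.
  apply: (divides_cancel t0); rewrite mulrC -ed1.
  by rewrite (_ : _ * _ = a) // ea eg1; ring.
have hc' : divides h1 c'.
  apply: (@gauss_divides h1 g1) => [y yh yg|].
    have yh' := lift _ _ _ eh1 yh; have yg' := lift _ _ _ eg1 yg.
    apply: copr; first by rewrite ea; apply: divides_mull.
      by rewrite eb; apply: divides_mull.
    exact: divides_trans hc.
  apply: (divides_cancel t0); rewrite mulrC -eh1.
  by rewrite (_ : _ * _ = c) // ec eg1; ring.
have e1 : u * a' + v * c' = 1.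
  by apply: (mulIf g0); rewrite mul1r [RHS]eg ea ec; ring.
have [l el] := da'; have [k ek] := hc'; have [b'' eb''] := db.
exists (u * l + v * k * u' * b''), (v * k * v').
transitivity (u * l * d + v * k * h).
  by rewrite -[LHS]mul1r -e1 el ek ed1 eh1; ring.
by rewrite eh eb''; ring.
Qed.

(** The ideal generated by the family enters only as an arbitrary [J] that
    contains the family and is closed under linear combinations, which spares
    any bookkeeping of coefficients during the induction. *)
Lemma pairwise_bezout_gcd (J : R -> Prop) a (s : seq R) :
  (forall u v x y, J x -> J y -> J (u * x + v * y)) ->
  {in a :: s, forall x, J x} ->
  {in a :: s &, forall x y, exists d, bezout_gcd x y d} ->
  exists2 d, J d & {in a :: s, forall x, divides d x}.
Proof.
move=> Jlin; elim: s a => [|b s IHs] a Js pair_s.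
  exists a; first by apply: Js; rewrite mem_head.
  by move=> x; rewrite inE => /eqP->; apply: dividesxx.
have a_in : a \in [:: a, b & s] by rewrite !inE eqxx.
have b_in : b \in [:: a, b & s] by rewrite !inE eqxx orbT.
have s_in x : x \in s -> x \in [:: a, b & s] by rewrite !inE => ->; rewrite !orbT.
have [d abd] := pair_s a b a_in b_in.
have merge c : c \in s -> exists t, bezout_gcd d c t.
  move=> /s_in c_in.
  have [g acg] := pair_s a c a_in c_in; have [h bch] := pair_s b c b_in c_in.
  exact: bezout_gcd_merge abd acg bch.
have [||e Je es] := IHs d.
- move=> x; rewrite inE => /orP[/eqP->|/s_in/Js//].
  by have [_ _ [u [v ->]]] := abd; apply: Jlin; apply: Js.
- move=> x y; rewrite !inE => /orP[/eqP->|xs] /orP[/eqP->|ys].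
  + by exists d; apply: bezout_gcdxx.
  + exact: merge.
  + by have [t /bezout_gcdC] := merge x xs; exists t.
  + by apply: pair_s; apply: s_in.
have [da db _] := abd.
have ed : divides e d by apply: es; rewrite mem_head.
exists e => // x; rewrite !inE => /or3P[/eqP->|/eqP->|xs].
- exact: divides_trans da.
- exact: divides_trans db.
- by apply: es; rewrite inE xs orbT.
Qed.

Lemma family_bezout_gcd n (p : 'I_n -> R) :
  (0 < n)%N ->
  (forall i j, exists d, bezout_gcd (p i) (p j) d) ->
  exists w : 'I_n -> R, forall i, divides (\sum_j w j * p j) (p i).
Proof.
move=> n_gt0 pair_p.
pose J x := exists w : 'I_n -> R, x = \sum_j w j * p j.
have Jlin u v x y : J x -> J y -> J (u * x + v * y).
  move=> [w ->] [w' ->]; exists (fun j => u * w j + v * w' j).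
  by rewrite !mulr_sumr -big_split; apply: eq_bigr => j _ /=; ring.
have Jp i : J (p i).
  exists (fun j => (j == i)%:R); rewrite (bigD1 i) //= eqxx mul1r big1 ?addr0 //.
  by move=> j /negPf->; rewrite mul0r.
have : p (Ordinal n_gt0) \in codom p by apply: codom_f.
case ep: (codom p) => [//|a s] _.
have [||d [w ->] dvd] := @pairwise_bezout_gcd J a s Jlin; rewrite -?ep.
- by move=> x /codomP[i ->].
- by move=> x y /codomP[i ->] /codomP[j ->].
by exists w => i; apply: dvd; rewrite -ep codom_f.
Qed.

End BezoutGcd.

(** * Principal ideals *)

Section PrincipalIdeals.
Variable R : idomainType.

Lemma bezout_gcd_of_principal_sum (a b : R) :
  principal_ideal (ideal_add [set c * a | c in [set: R]]
                             [set c * b | c in [set: R]]) ->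
  exists d, bezout_gcd a b d.
Proof.
move=> [d e]; exists d.
have memP x : (exists u v, x = u * a + v * b) <-> divides d x.
  suff -> : divides d x = ideal_add [set c * a | c in [set: R]]
                             [set c * b | c in [set: R]] x.
    split=> [[u [v ->]]|[_ [u _ <-] [_ [v _ <-] <-]]]; last by exists u, v.
    by exists (u * a); [exists u|exists (v * b) => //; exists v].
  rewrite e; apply: boolp.propext; split=> [[c ->]|[c _ <-]]; last by exists c.
  by exists c.
split; [apply/memP|apply/memP|apply/memP; exact: dividesxx].
- by exists 1, 0; rewrite mul1r mul0r addr0.
- by exists 0, 1; rewrite mul1r mul0r add0r.
Qed.

Lemma principal_ideal_sum n (p w : 'I_n -> R) :
  (forall i, divides (\sum_j w j * p j) (p i)) ->
  principal_ideal (ideal_sum (fun i => [set c * p i | c in [set: R]])).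
Proof.
move=> dvd; exists (\sum_j w j * p j); apply/seteqP; split=> x /=.
  move=> [y yI <-]; have [k ek] := fin_all_exists dvd.
  have /fin_all_exists[c ec] i : exists c, y i = c * p i.
    by have [c _ <-] := yI i; exists c.
  exists (\sum_i c i * k i) => //.
  by rewrite mulr_suml; apply: eq_bigr => i _; rewrite ec -mulrA -ek.
move=> [c _ <-]; exists (fun j => c * w j * p j) => [j|]; first by exists (c * w j).
by rewrite mulr_sumr; apply: eq_bigr => j _; rewrite mulrA.
Qed.

End PrincipalIdeals.

Theorem theorem2 (R : idomainType) (ufdR : is_ufd R) (n : nat)
    (n_gt0 : (0 < n)%N) :
  (forall p : 'I_n -> R,
     (forall i, p i != 0) ->
     (forall i j : 'I_n, (i < j)%N ->
        exists u v : R, is_gcd [:: p i; p j] (u * p i + v * p j)) ->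
     exists w : 'I_n -> R, is_gcd (codom p) (\sum_i w i * p i)) /\
  (forall I : 'I_n -> set R,
     (forall i, principal_ideal (I i)) ->
     (forall i j : 'I_n, principal_ideal (ideal_add (I i) (I j))) ->
     principal_ideal (ideal_sum I)).
Proof.
have gcdR (a b : R) : exists d, is_gcd [:: a; b] d by apply: ufd_gcd.
split=> [p _ pair_p|I I_princ pair_I].
  have lt_bezout (i j : 'I_n) : (i < j)%N -> exists d, bezout_gcd (p i) (p j) d.
    move=> /pair_p[u [v /is_gcd2P[di dj _]]].
    by exists (u * p i + v * p j); split=> //; exists u, v.
  have [i j|w dvd] := family_bezout_gcd gcdR (p := p) n_gt0.
    case: (ltngtP i j) => [/lt_bezout//|/lt_bezout[d /bezout_gcdC]|/val_inj->].
      by exists d.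
    by exists (p j); apply: bezout_gcdxx.
  exists w; split=> [_ /codomP[i ->]//|c dvd_c].
  elim/big_ind: _ => [|x y cx cy|i _]; first exact: divides0.
    by have := divides_lin 1 1 cx cy; rewrite !mul1r.
  by apply: divides_mull; apply: dvd_c; apply: codom_f.
have [p ep] := fin_all_exists I_princ.
have -> : I = fun i => [set c * p i | c in [set: R]] by apply: boolp.funext.
have [i j|w dvd] := family_bezout_gcd gcdR (p := p) n_gt0.
  by apply: bezout_gcd_of_principal_sum; rewrite -!ep.
exact: principal_ideal_sum dvd.
Qed.
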